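(* For every stream $s$: if $\mu\mathcal{W}\,s$, then $\neg\,\mathcal{G}\,(\neg\,\mathcal{G}\,\mathit{blue})\,s$.
   Context: The statement is to be proved constructively (intuitionistic type theory with inductive and coinductive definitions; no excluded middle, no Markov's principle). A color is one of $R$ (red), $B$ (blue). A stream is an element of the coinductive type whose only constructor forms $c\,s$ from a color $c$ and a stream $s$; streams are considered up to bisimilarity (equivalently, functions $\mathbb{N}\to\{R,B\}$ up to pointwise equality). $\mathit{blue}\,s$ means that $s=B\,s'$ for some $s'$. For a stream predicate $X$, $\mathcal{G}\,X$ is defined coinductively by the rule: $X\,(c\,s)$ and $\mathcal{G}\,X\,s$ imply $\mathcal{G}\,X\,(c\,s)$. Negation is lifted to predicates pointwise: $\neg\,\mathcal{G}\,\mathit{blue}$ inside $\mathcal{G}(\cdot)$ is the predicate $t\mapsto\neg(\mathcal{G}\,\mathit{blue}\,t)$. For a stream predicate $X$, the weak until predicate $\mathcal{W}_X$ is defined coinductively by the rules: $\mathcal{W}_X\,s$ implies $\mathcal{W}_X\,(B\,s)$; $X\,s$ implies $\mathcal{W}_X\,(R\,s)$. The operator $X\mapsto\mathcal{W}_X$ is monotone, and $\mu\mathcal{W}$ (''almost always blue'') is its least fixed point, i.e. the predicate defined inductively by the rule: $\mathcal{W}_{\mu\mathcal{W}}\,s$ implies $\mu\mathcal{W}\,s$ (equivalently, Mendler-style: if $X$ is a stream predicate with $\forall s'.\,X\,s'\Rightarrow\mu\mathcal{W}\,s'$ and $\mathcal{W}_X\,s$, then $\mu\mathcal{W}\,s$).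 *)

(* Defs.v *)
(* Standard library, vanilla Rocq. *)
From Stdlib Require Export Streams.

Inductive color : Set := R | B.

Definition stream := Stream color.

Definition blue (s : stream) : Prop := exists s' : stream, s = Cons B s'.

Definition neg (X : stream -> Prop) : stream -> Prop := fun t => ~ X t.

(* The library's [ForAll X s] is coinductively generated by
   [X s -> ForAll X (tl s) -> ForAll X s]. *)
Definition G (X : stream -> Prop) : stream -> Prop := ForAll X.

CoInductive W (X : stream -> Prop) : stream -> Prop :=
| W_blue : forall s, W X s -> W X (Cons B s)
| W_red : forall s, X s -> W X (Cons R s).

(* The Mendler-style rule: the direct rule [W muW s -> muW s] nests the
   inductive predicate inside a coinductive one, and Rocq then offers no usable
   recursion through [W].  [muW_fold] is the direct rule, and [muW_least] says
   that [muW] is the least predicate closed under it. *)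
Inductive muW : stream -> Prop :=
| muW_intro : forall (X : stream -> Prop) (s : stream),
    (forall s', X s' -> muW s') -> W X s -> muW s.

Lemma W_mono (X Y : stream -> Prop) :
  (forall s, X s -> Y s) -> forall s, W X s -> W Y s.
Proof.
  intro XY; cofix IH; intros s [t Ht | t Ht].
  - apply W_blue, IH, Ht.
  - apply W_red, XY, Ht.
Qed.

Lemma muW_fold (s : stream) : W muW s -> muW s.
Proof. apply muW_intro; trivial. Qed.

Lemma muW_unfold (s : stream) : muW s -> W muW s.
Proof. intros [X t XmuW H]; exact (W_mono X muW XmuW t H). Qed.

Lemma muW_least (P : stream -> Prop) :
  (forall s, W P s -> P s) -> forall s, muW s -> P s.
Proof.
  intros closed s H; induction H as [X s _ IH H].
  apply closed; exact (W_mono X P IH s H).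
Qed.

(* Main.v *)
(* If the almost always blue stream [s] satisfied [G (neg (G blue))], then, by
   induction on [muW], no tail after a red element could satisfy it.  Following
   the weak until, a red element is therefore contradictory, so [s] is always
   blue, which [neg (G blue) s] excludes. *)
Require Import Defs.

(** [G X] passes to tails, so right after a red it would meet its own negation. Only blue steps
    remain, and they build [G blue] corecursively, without deciding whether a red ever occurs. *)
Lemma W_neg_G_blue (X : stream -> Prop) (s : stream) :
  W (neg (G X)) s -> G X s -> G blue s.
Proof.
  revert s; cofix IH; intros _ [t Ht | t Ht] [_ GX].
  - constructor.
    + now exists t.
    + exact (IH t Ht GX).
  - destruct (Ht GX).
Qed.

Theorem lemma4p4 (s : stream) : muW s -> ~ G (neg (G blue)) s.
Proof.
  (* With this predicate, closure under [W] supplies exactly the weak until that [W_neg_G_blue]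
     expects for [X := neg (G blue)]. *)
  apply (muW_least (neg (G (neg (G blue))))).
  intros t Wt Gt.
  assert (not_blue : neg (G blue) t) by now destruct Gt.
  exact (not_blue (W_neg_G_blue _ t Wt Gt)).
Qed.
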